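(* Consider $N_{\rm t}\ge 1$ transmit antennas, $N_{\rm ris}\ge 1$ passive scatterers of a reconfigurable intelligent surface (RIS) and $N_{\rm r}\ge 1$ receive antennas, all thin wires parallel to the $z$-axis, satisfying the thin-wire model with boundary conditions described in the context. Let $\mathbf V_{\rm G}\in\mathbb C^{N_{\rm t}}$ be the vector of generator voltages $V_{{\rm G}t}$ and $\mathbf V_{\rm L}\in\mathbb C^{N_{\rm r}}$ the vector of voltages $V_{{\rm L}r}$ at the receive ports. Let $\mathbf Z_{\rm G}$ ($N_{\rm t}\times N_{\rm t}$), $\mathbf Z_{\rm RIS}$ ($N_{\rm ris}\times N_{\rm ris}$) and $\mathbf Z_{\rm L}$ ($N_{\rm r}\times N_{\rm r}$) be the complex diagonal matrices of the generator internal impedances, of the tunable RIS loads, and of the receiver loads. For $X,Y\in\{{\rm T},{\rm S},{\rm R}\}$ (transmitter, RIS, receiver) let $\mathcal Z_{XY}$ be the matrix whose $(x,y)$ entry is the mutual impedance $Z_{xy}$ (self impedance if the two elements coincide), defined in the context, between the $x$th radiating element of $X$ and the $y$th radiating element of $Y$. Put $$\mathcal P_{X{\rm S}Y}=\mathcal Z_{XY}-\mathcal Z_{X{\rm S}}\left(\mathbf Z_{\rm RIS}+\mathcal Z_{\rm SS}\right)^{-1}\mathcal Z_{{\rm S}Y},\qquad \mathcal P_{\rm GTST}=\mathbf Z_{\rm G}+\mathcal P_{\rm TST}.$$ Assume that $\mathbf Z_{\rm L}$, $\mathbf Z_{\rm RIS}+\mathcal Z_{\rm SS}$, $\mathcal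 P_{\rm GTST}$ and $\mathbf I_{N_{\rm r}\times N_{\rm r}}+\mathcal P_{\rm RSR}\mathbf Z_{\rm L}^{-1}-\mathcal P_{\rm RST}\mathcal P_{\rm GTST}^{-1}\mathcal P_{\rm TSR}\mathbf Z_{\rm L}^{-1}$ are invertible. Then $$\mathbf V_{\rm L}=\mathcal H_{\rm E2E}\,\mathbf V_{\rm G},\qquad \mathcal H_{\rm E2E}=\left(\mathbf I_{N_{\rm r}\times N_{\rm r}}+\mathcal P_{\rm RSR}\mathbf Z_{\rm L}^{-1}-\mathcal P_{\rm RST}\mathcal P_{\rm GTST}^{-1}\mathcal P_{\rm TSR}\mathbf Z_{\rm L}^{-1}\right)^{-1}\mathcal P_{\rm RST}\,\mathcal P_{\rm GTST}^{-1}.$$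
   Context: Constants: $k_0>0$ (wavenumber), $\eta_0>0$, $c_E=-j\eta_0/(4\pi k_0)$, $j=\sqrt{-1}$. Radiating elements: each element $\chi$ (transmit antenna, RIS scatterer or receive antenna) is a perfectly conducting thin wire parallel to the $z$-axis, centered at $(x_\chi,y_\chi,z_\chi)\in\mathbb R^3$, of length $l_\chi>0$ and radius $a_\chi>0$, with $\sin(k_0l_\chi/2)\ne0$. It carries the current $I_{z,\chi}(z')=\mathcal I_\chi\,\tilde I_\chi(z')$ for $|z'-z_\chi|\le l_\chi/2$, where $\mathcal I_\chi\in\mathbb C$ is its port current and $$\tilde I_\chi(z')=\frac{\sin\left(k_0(l_\chi/2-|z'-z_\chi|)\right)}{\sin(k_0l_\chi/2)}.$$ Radiated field: the $z$-component at $\mathbf r=(x,y,z)$ of the electric field radiated by element $p$ is $$E^{(\rm rad)}_{z,p}(\mathbf r)=c_E\int_{z_p-l_p/2}^{z_p+l_p/2}\mathcal F_p(\mathbf r,z')\,\mathcal G_p(\mathbf r,z')\,I_{z,p}(z')\,dz',$$ where $\mathcal G_p=e^{-jk_0\mathcal R_p}/\mathcal R_p$; $\mathcal R_p(\mathbf r,z')=\sqrt{a_p^2+(z-z')^2}$ if $(x,y)=(x_p,y_p)$ and $\mathcal R_p(\mathbf r,z')=\sqrt{(x-x_p)^2+(y-y_p)^2+(z-z')^2}$ otherwise; and $$\mathcal F_p(\mathbf r,z')=\frac{(z-z')^2}{\mathcal R_p^2}\left(\frac3{\mathcal R_p^2}+\frac{3jk_0}{\mathcal R_p}-k_0^2\right)-\frac{jk_0+1/\mathcal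 R_p}{\mathcal R_p}+k_0^2 .$$ Mutual impedances: for elements $q,p$ (possibly equal), $$Z_{qp}=\int_{z_q-l_q/2}^{z_q+l_q/2}\int_{z_p-l_p/2}^{z_p+l_p/2}\frac{j\eta_0}{4\pi k_0}\,\mathcal F_p(\mathbf r_{\mathcal S_q},z')\,\mathcal G_p(\mathbf r_{\mathcal S_q},z')\,\tilde I_p(z')\,\tilde I_q(z'')\,dz'\,dz'',\qquad \mathbf r_{\mathcal S_q}=(x_q,y_q,z'').$$ Boundary conditions (delta-gap model): let $V_q\in\mathbb C$ be the port voltage of element $q$. The incident field on the surface of $q$ is $V_q\,\delta(z''-z_q)$, and the total tangential field on the surface of $q$ vanishes: $\sum_pE^{(\rm rad)}_{z,p}(\mathbf r_{\mathcal S_q})=-V_q\,\delta(z''-z_q)$, the sum being over all $N_{\rm t}+N_{\rm ris}+N_{\rm r}$ elements. This is understood in the weak sense of testing against the current profile of $q$, that is, $$\sum_p\int_{z_q-l_q/2}^{z_q+l_q/2}E^{(\rm rad)}_{z,p}(\mathbf r_{\mathcal S_q})\,\tilde I_q(z'')\,dz''=-V_q\qquad\text{for every element } q.$$ Terminations: with port voltage vectors $\mathbf V_{\rm T},\mathbf V_{\rm S},\mathbf V_{\rm L}$ and port current vectors $\mathbf I_{\rm T},\mathbf I_{\rm S},\mathbf I_{\rm L}$ of the transmitter, RIS and receiver, one has $\mathbf V_{\rm T}=\mathbf V_{\rm G}-\mathbf Z_{\rm G}\mathbf I_{\rm T}$, $\mathbf V_{\rm S}=-\mathbf Z_{\rm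 RIS}\mathbf I_{\rm S}$, $\mathbf V_{\rm L}=-\mathbf Z_{\rm L}\mathbf I_{\rm L}$. *)

(* Defs.v *)
From mathcomp Require Import all_boot all_order all_algebra.
From mathcomp Require Import all_classical all_reals all_analysis.
From mathcomp Require Export complex.

Set Implicit Arguments.
Unset Strict Implicit.
Unset Printing Implicit Defensive.

Import Order.TTheory GRing.Theory Num.Theory.

Local Open Scope classical_set_scope.
Local Open Scope ring_scope.
Local Open Scope complex_scope.

(* Not ['i]: under the scopes in use it denotes [Num.imaginary]. *)
Definition jC (R : realType) : R[i] := 0 +i* 1.

Definition cexp (R : realType) (z : R[i]) : R[i] :=
  (expR (complex.Re z))%:C
  * (cos (complex.Im z) +i* sin (complex.Im z)).

(* The Lebesgue integral of a complex-valued function over [a, b], taken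
   componentwise. *)
Definition cintegral (R : realType) (a b : R) (f : R -> R[i]) : R[i] :=
  (\int[@lebesgue_measure R]_(t in `[a, b]) complex.Re (f t))
  +i* (\int[@lebesgue_measure R]_(t in `[a, b]) complex.Im (f t)).

Record wire (R : realType) := Wire {
  wx : R;
  wy : R;
  wz : R;
  wlen : R;
  wrad : R
}.

Definition wire_ok (R : realType) (k0 : R) (w : wire R) : Prop :=
  [/\ 0 < wlen w, 0 < wrad w & sin (k0 * wlen w / 2) != 0].

Definition wire_lo (R : realType) (w : wire R) : R := wz w - wlen w / 2.
Definition wire_hi (R : realType) (w : wire R) : R := wz w + wlen w / 2.

(* Only meaningful for z' in [wire_lo w, wire_hi w]; every integral below
   evaluates it only there. *)
Definition profile (R : realType) (k0 : R) (w : wire R) (z' : R) : R :=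
  sin (k0 * (wlen w / 2 - `|z' - wz w|)) / sin (k0 * wlen w / 2).

Definition current (R : realType) (k0 : R) (w : wire R) (Iport : R[i])
    (z' : R) : R[i] :=
  Iport * (profile k0 w z')%:C.

(* On the axis of the wire the horizontal distance is replaced by the
   radius. *)
Definition dist (R : realType) (p : wire R) (x y z z' : R) : R :=
  if (x, y) == (wx p, wy p) then
    Num.sqrt (wrad p ^+ 2 + (z - z') ^+ 2)
  else
    Num.sqrt ((x - wx p) ^+ 2 + (y - wy p) ^+ 2 + (z - z') ^+ 2).

Definition kernelG (R : realType) (k0 : R) (p : wire R) (x y z z' : R) : R[i] :=
  let rho := (dist p x y z z')%:C in
  cexp (- (jC R * k0%:C * rho)) / rho.

Definition kernelF (R : realType) (k0 : R) (p : wire R) (x y z z' : R) : R[i] :=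
  let rho := (dist p x y z z')%:C in
  let k := k0%:C in
  (z - z')%:C ^+ 2 / rho ^+ 2
    * (3 / rho ^+ 2 + 3 * jC R * k / rho - k ^+ 2)
  - (jC R * k + 1 / rho) / rho + k ^+ 2.

Definition cE (R : realType) (k0 eta0 : R) : R[i] :=
  - (jC R * eta0%:C) / (4 * (pi : R)%:C * k0%:C).

Definition Erad (R : realType) (k0 eta0 : R) (p : wire R) (Iport : R[i])
    (x y z : R) : R[i] :=
  cE k0 eta0 *
  cintegral (wire_lo p) (wire_hi p) (fun z' =>
    kernelF k0 p x y z z' * kernelG k0 p x y z z' * current k0 p Iport z').

Definition mutual_impedance (R : realType) (k0 eta0 : R) (q p : wire R) : R[i] :=
  cintegral (wire_lo q) (wire_hi q) (fun z'' =>
    cintegral (wire_lo p) (wire_hi p) (fun z' =>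
      jC R * eta0%:C / (4 * (pi : R)%:C * k0%:C)
      * kernelF k0 p (wx q) (wy q) z'' z'
      * kernelG k0 p (wx q) (wy q) z'' z'
      * (profile k0 p z')%:C * (profile k0 q z'')%:C)).

(* The total tangential field vanishes on every wire, the incident field being
   the delta-gap [V q * delta (z'' - wz (w q))]; weak form, tested against the
   current profile of [q] (whose value at the gap is 1). *)
Definition boundary_conditions (R : realType) (k0 eta0 : R) (E : finType)
    (w : E -> wire R) (V Iport : E -> R[i]) : Prop :=
  forall q : E,
    \sum_(p : E)
      cintegral (wire_lo (w q)) (wire_hi (w q)) (fun z'' =>
        Erad k0 eta0 (w p) (Iport p) (wx (w q)) (wy (w q)) z''
        * (profile k0 (w q) z'')%:C)
    = - V q.

Definition element (Nt Nris Nr : nat) : finType := ('I_Nt + 'I_Nris + 'I_Nr)%type.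

Definition per_element (A : Type) (Nt Nris Nr : nat)
    (t : 'I_Nt -> A) (s : 'I_Nris -> A) (r : 'I_Nr -> A)
    (e : element Nt Nris Nr) : A :=
  match e with
  | inl (inl i) => t i
  | inl (inr i) => s i
  | inr i => r i
  end.

Definition impedance_mx (R : realType) (k0 eta0 : R) (m n : nat)
    (X : 'I_m -> wire R) (Y : 'I_n -> wire R) : 'M[R[i]]_(m, n) :=
  \matrix_(i < m, j < n) mutual_impedance k0 eta0 (X i) (Y j).

(* The matrix P_XSY, for a RIS with wires [S] and load matrix [Zris]. *)
Definition ris_mx (R : realType) (k0 eta0 : R) (m n s : nat)
    (Zris : 'M[R[i]]_s) (X : 'I_m -> wire R) (S : 'I_s -> wire R)
    (Y : 'I_n -> wire R) : 'M[R[i]]_(m, n) :=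
  impedance_mx k0 eta0 X Y
  - impedance_mx k0 eta0 X S
    *m invmx (Zris + impedance_mx k0 eta0 S S)
    *m impedance_mx k0 eta0 S Y.

(* Main.v *)
(* The kernels depend on z and z' only through z - z' and are continuous, since
   the distance never vanishes; so all integrands are integrable, complex
   scalars can be pulled out of the integrals, and the field of p tested on q
   is -Z_qp I_p.  The boundary conditions thus read V = Z I.  Eliminating the
   RIS currents gives a Schur complement, and eliminating the transmit and
   receive currents gives the transfer matrix. *)

Require Import Defs.
From mathcomp Require Import all_boot all_order all_algebra.
From mathcomp Require Import all_classical all_reals all_analysis.
From mathcomp Require Import ring.

Set Implicit Arguments.
Unset Strict Implicit.
Unset Printing Implicit Defensive.

Import Order.TTheory GRing.Theory Num.Theory numFieldNormedType.Exports.

Local Open Scope classical_set_scope.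
Local Open Scope ring_scope.
Local Open Scope complex_scope.

(** * Continuity, bounds and integrals on compact intervals *)

Lemma continuous_integrable_itv (R : realType) (f : R -> R) (a b : R) :
  continuous f ->
  (@lebesgue_measure R).-integrable `[a, b] (EFin \o f).
Proof.
move=> cf; apply: continuous_compact_integrable; first exact: segment_compact.
exact: continuous_subspaceT.
Qed.

Lemma continuous_bounded_itv (R : realType) (f : R -> R) (a b : R) :
  continuous f -> exists M : R, forall x, x \in `[a, b]%R -> `|f x| <= M.
Proof.
move=> cf.
have /compact_bounded[M [_ HM]] : compact (f @` `[a, b]).
  apply: continuous_compact; last exact: segment_compact.
  exact: continuous_subspaceT.
(* [HM] gives a bound only for reals strictly above [M]. *)
exists (M + 1) => x xab; apply: (HM (M + 1)); first by rewrite ltrDl.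
by exists x.
Qed.

Lemma continuous_compose (R : realType) (f g : R -> R) :
  continuous f -> continuous g -> continuous (fun x => g (f x)).
Proof. by move=> cf cg x; apply: continuous_comp; [exact: cf|exact: cg]. Qed.

(** Dominated convergence gives continuity under the integral sign. It is applied on a bounded
    window around each point, since [f] need not be bounded on the whole line. *)
Lemma continuous_convolution_itv (R : realType) (f g : R -> R) (a b : R) :
  continuous f -> continuous g ->
  continuous
    (fun z => \int[@lebesgue_measure R]_(t in `[a, b]) (f (z - t) * g t)).
Proof.
move=> cf cg z0.
have cfz z : continuous (fun t => f (z - t)).
  move=> t; apply: (@continuous_comp _ _ _ (fun t => z - t) f); last exact: cf.
  by apply: cvgB; [exact: cvg_cst|exact: cvg_id].
(* For [z] within 1 of [z0] and [t] in [[a, b]], the difference [z - t] stays in this interval, so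
   the constant [Mf * Mg] dominates the integrand. *)
have [Mf HMf] := continuous_bounded_itv (z0 - 1 - b) (z0 + 1 - a) cf.
have [Mg HMg] := continuous_bounded_itv a b cg.
pose I : set R := `]z0 - 1, z0 + 1[%classic.
have : {in I, continuous (fun z =>
    \int[@lebesgue_measure R]_(t in `[a, b]) (f (z - t) * g t))}.
  apply: (@continuity_under_integral R _ _ (@lebesgue_measure R)
    (fun z t => f (z - t) * g t) `[a, b]%classic _ (z0 - 1) (z0 + 1)
    _ _ (fun=> Mf * Mg)) => //.
  - move=> z _; apply: continuous_integrable_itv => t.
    by apply: cvgM; [exact: cfz|exact: cg].
  - apply: aeW => t _ z _; apply: cvgM; last exact: cvg_cst.
    apply: (@continuous_comp _ _ _ (fun z => z - t) f); last exact: cf.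
    by apply: cvgB; [exact: cvg_id|exact: cvg_cst].
  - apply: (@continuous_integrable_itv R (fun=> Mf * Mg)) => t.
    exact: cvg_cst.
  - move=> z Iz; apply: aeW => t tab.
    rewrite normrM ler_pM//; last exact: HMg.
    apply: HMf; move: Iz tab; rewrite /= !in_itv/= => /andP[h1 h2] /andP[h3 h4].
    by apply/andP; split; apply: lerB => //; exact: ltW.
by apply; rewrite inE/= /I/= in_itv/= ltrDl ltrBlDr ltrDl ltr01.
Qed.

(** * Complex-valued functions, handled componentwise *)

Definition ccontinuous (R : realType) (f : R -> R[i]) : Prop :=
  continuous (fun t => complex.Re (f t)) /\
  continuous (fun t => complex.Im (f t)).

Lemma ccontinuous_cst (R : realType) (c : R[i]) :
  ccontinuous (fun=> c).
Proof. by split=> t; exact: cvg_cst. Qed.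

Lemma ccontinuous_real (R : realType) (f : R -> R) :
  continuous f -> ccontinuous (fun t => (f t)%:C).
Proof. by move=> cf; split=> t; [exact: cf|exact: cvg_cst]. Qed.

Lemma ccontinuousD (R : realType) (f g : R -> R[i]) :
  ccontinuous f -> ccontinuous g -> ccontinuous (fun t => f t + g t).
Proof.
move=> [rf mf] [rg mg]; split=> t.
- under eq_fun do rewrite raddfD/=.
  by apply: cvgD; [exact: rf|exact: rg].
- under eq_fun do rewrite raddfD/=.
  by apply: cvgD; [exact: mf|exact: mg].
Qed.

Lemma ReM (R : realType) (x y : R[i]) : complex.Re (x * y) =
  complex.Re x * complex.Re y - complex.Im x * complex.Im y.
Proof. by case: x y => [? ?] [? ?]. Qed.

Lemma ImM (R : realType) (x y : R[i]) : complex.Im (x * y) =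
  complex.Re x * complex.Im y + complex.Im x * complex.Re y.
Proof. by case: x y => [? ?] [? ?]. Qed.

Lemma ccontinuousM (R : realType) (f g : R -> R[i]) :
  ccontinuous f -> ccontinuous g -> ccontinuous (fun t => f t * g t).
Proof.
move=> [rf mf] [rg mg]; split=> t.
- under eq_fun do rewrite ReM.
  by apply: cvgB; apply: cvgM; [exact: rf|exact: rg|exact: mf|exact: mg].
- under eq_fun do rewrite ImM.
  by apply: cvgD; apply: cvgM; [exact: rf|exact: mg|exact: mf|exact: rg].
Qed.

(** A complex scalar mixes the real and imaginary parts, so each component is a combination of two
    real integrals. Continuity supplies the integrability needed to split them. *)
Lemma cintegralZl (R : realType) (a b : R) (c : R[i]) (f : R -> R[i]) :
  ccontinuous f -> cintegral a b (fun t => c * f t) = c * cintegral a b f.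
Proof.
move=> [cr ci].
have ir := continuous_integrable_itv a b cr.
have ii := continuous_integrable_itv a b ci.
have iZ k (h : R -> R) :
    (@lebesgue_measure R).-integrable `[a, b] (EFin \o h) ->
    (@lebesgue_measure R).-integrable `[a, b] (EFin \o (fun t => k * h t)).
  by move=> ih; exact: (integrableZl _ k ih).
rewrite /cintegral; apply/eqP; rewrite eq_complex ReM ImM/=.
apply/andP; split; apply/eqP.
- under eq_Rintegral do rewrite ReM.
  by rewrite RintegralB ?RintegralZl//; exact: iZ.
- under eq_Rintegral do rewrite ImM.
  by rewrite RintegralD ?RintegralZl//; exact: iZ.
Qed.

(** As [g] is real there are no cross terms: each component is itself a real convolution. *)
Lemma ccontinuous_convolution (R : realType) (a b : R) (f : R -> R[i])
    (g : R -> R) :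
  ccontinuous f -> continuous g ->
  ccontinuous (fun z => cintegral a b (fun t => f (z - t) * (g t)%:C)).
Proof.
move=> [rf mf] cg; split => /=.
- under eq_fun do under eq_Rintegral do rewrite ReM/= mulr0 subr0.
  exact: (@continuous_convolution_itv R _ _ a b rf cg).
- under eq_fun do under eq_Rintegral do rewrite ImM/= mulr0 add0r.
  exact: (@continuous_convolution_itv R _ _ a b mf cg).
Qed.

(** * Thin-wire kernels and the tested field *)

Lemma profile_continuous (R : realType) (k0 : R) (w : wire R) :
  continuous (profile k0 w).
Proof.
move=> t; apply: cvgM; last exact: cvg_cst.
apply: (@continuous_comp _ _ _ (fun t => k0 * (wlen w / 2 - `|t - wz w|)) sin);
  last exact: continuous_sin.
apply: cvgM; first exact: cvg_cst.
apply: cvgB; first exact: cvg_cst.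
apply: (@continuous_comp _ _ _ (fun t => t - wz w) Num.norm);
  last exact: norm_continuous.
by apply: cvgB; [exact: cvg_id|exact: cvg_cst].
Qed.

(** Translation invariance along the wire direction; it turns the integral over the source wire into
    a convolution. *)
Lemma kernel_shift (R : realType) (k0 : R) (p : wire R) (x y z z' : R) :
  kernelF k0 p x y z z' * kernelG k0 p x y z z' =
  kernelF k0 p x y (z - z') 0 * kernelG k0 p x y (z - z') 0.
Proof. by rewrite /kernelF /kernelG /dist !subr0. Qed.

(** On the axis the radius keeps the distance positive; off the axis one of the two horizontal
    offsets is nonzero. *)
Lemma dist_gt0 (R : realType) (p : wire R) (x y z z' : R) :
  0 < wrad p -> 0 < dist p x y z z'.
Proof.
move=> rp; rewrite /dist; case: ifPn => [_|].
  by rewrite sqrtr_gt0 ltr_pwDl ?sqr_ge0// exprn_gt0.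
rewrite xpair_eqE negb_and sqrtr_gt0 => xy.
rewrite ltr_pwDl ?sqr_ge0// lt0r addr_ge0 ?sqr_ge0// andbT.
by rewrite paddr_eq0 ?sqr_ge0// !sqrf_eq0 !subr_eq0 negb_and.
Qed.

Lemma dist_continuous (R : realType) (p : wire R) (x y : R) :
  continuous (fun u => dist p x y u 0).
Proof.
(* Both branches of [dist] have this form, and the test selecting the branch does not involve
   [u]. *)
have csqrt (c : R) : continuous (fun u : R => Num.sqrt (c + (u - 0) ^+ 2)).
  move=> u; apply: (@continuous_comp _ _ _ (fun u : R => c + (u - 0) ^+ 2)
    Num.sqrt); last by apply: sqrt_continuous.
  have cB : {for u, continuous (fun u : R => u - 0)}.
    by apply: cvgB; [exact: cvg_id|exact: cvg_cst].
  by apply: cvgD; [exact: cvg_cst|exact: (cvgM cB cB)].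
by rewrite /dist; case: (_ == _); exact: csqrt.
Qed.

Lemma ccontinuous_kernel (R : realType) (k0 : R) (p : wire R) (x y : R) :
  0 < wrad p ->
  ccontinuous (fun u => kernelF k0 p x y u 0 * kernelG k0 p x y u 0).
Proof.
move=> rp.
have cd := @dist_continuous R p x y.
have cV : ccontinuous (fun u => ((dist p x y u 0)%:C)^-1).
  under eq_fun do rewrite -fmorphV.
  apply: ccontinuous_real => u; apply: cvgV; last exact: cd.
  by rewrite gt_eqF// dist_gt0.
have cu : ccontinuous (fun u : R => (u - 0)%:C).
  by apply: ccontinuous_real => u; apply: cvgB; [exact: cvg_id|exact: cvg_cst].
have cexpc : ccontinuous
    (fun u => cexp (- (jC R * k0%:C * (dist p x y u 0)%:C))).
  have ck : continuous (fun u => - (k0 * dist p x y u 0)).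
    by move=> u; apply: cvgN; apply: cvgM; [exact: cvg_cst|exact: cd].
  (* The exponent is purely imaginary, so the modulus factor of [cexp] is 1 and only the phase
     remains. *)
  rewrite (_ : (fun u => _) = (fun u => cos (- (k0 * dist p x y u 0)) +i*
                                       sin (- (k0 * dist p x y u 0)))).
    split=> u /=.
      exact: (continuous_compose ck (@continuous_cos R)).
    exact: (continuous_compose ck (@continuous_sin R)).
  apply/funext => u; rewrite /cexp.
  rewrite (_ : jC R * k0%:C * (dist p x y u 0)%:C =
               0 +i* (k0 * dist p x y u 0)).
    by rewrite /= oppr0 expR0 mul1r.
  apply/eqP; rewrite eq_complex !(ReM, ImM)/=.
  by apply/andP; split; apply/eqP; ring.
apply: ccontinuousM; last exact: ccontinuousM.
rewrite /kernelF.
(* With [d] the vertical offset and [v] the inverse distance, this is [kernelF] written as a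
   polynomial, using sums and products only so that closure under these two operations suffices. *)
have cF (d v : R -> R[i]) (j k : R[i]) : ccontinuous d -> ccontinuous v ->
    ccontinuous (fun u => d u * d u * (v u * v u)
      * (3 * (v u * v u) + 3 * j * k * v u + - (k * k))
      + -1 * ((j * k + 1 * v u) * v u) + k * k).
  have cC (c : R[i]) : ccontinuous (fun _ : R => c) by exact: ccontinuous_cst.
  move=> cd' cv; have cv2 := ccontinuousM cv cv.
  apply: (ccontinuousD (ccontinuousD (ccontinuousM
    (ccontinuousM (ccontinuousM cd' cd') cv2) _) _) (cC _)).
  - exact: (ccontinuousD (ccontinuousD (ccontinuousM (cC _) cv2)
      (ccontinuousM (cC _) cv)) (cC _)).
  - exact: (ccontinuousM (cC _)
      (ccontinuousM (ccontinuousD (cC _) (ccontinuousM (cC _) cv)) cv)).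
under eq_fun do rewrite !expr2 !invfM -[- (_ / _)]mulN1r.
exact: cF cu cV.
Qed.

(** The constant [cE] is the negative of the one in [mutual_impedance], and the port current factors
    out of the double integral by linearity. The positive radius makes the kernels continuous, which
    justifies moving scalars across the integrals. *)
Lemma tested_field (R : realType) (k0 eta0 : R) (q p : wire R) (I : R[i]) :
  0 < wrad p ->
  cintegral (wire_lo q) (wire_hi q) (fun z =>
    Erad k0 eta0 p I (wx q) (wy q) z * (profile k0 q z)%:C)
  = - (mutual_impedance k0 eta0 q p * I).
Proof.
move=> rp.
pose K z t := kernelF k0 p (wx q) (wy q) z t * kernelG k0 p (wx q) (wy q) z t.
(* The inner integral stripped of all scalars, as a function of the observation height. *)
pose g z := cintegral (wire_lo p) (wire_hi p)
  (fun t => K z t * (profile k0 p t)%:C).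
have cK z : ccontinuous (fun t => K z t * (profile k0 p t)%:C).
  apply: ccontinuousM; last exact/ccontinuous_real/profile_continuous.
  have [rK mK] := ccontinuous_kernel k0 (wx q) (wy q) rp.
  have cz : continuous (fun t => z - t).
    by move=> t; apply: cvgB; [exact: cvg_cst|exact: cvg_id].
  rewrite /K; under eq_fun do rewrite kernel_shift.
  split=> t.
    exact: (continuous_compose cz rK).
  exact: (continuous_compose cz mK).
have cg : ccontinuous g.
  rewrite /g /K; under eq_fun do (under eq_fun do rewrite kernel_shift).
  apply: (@ccontinuous_convolution R _ _
    (fun u => kernelF k0 p (wx q) (wy q) u 0 * kernelG k0 p (wx q) (wy q) u 0));
    last exact: profile_continuous.
  exact: ccontinuous_kernel.
have cgq : ccontinuous (fun z => g z * (profile k0 q z)%:C).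
  by apply: ccontinuousM => //; exact/ccontinuous_real/profile_continuous.
have -> : (fun z => Erad k0 eta0 p I (wx q) (wy q) z * (profile k0 q z)%:C) =
          (fun z => cE k0 eta0 * I * (g z * (profile k0 q z)%:C)).
  apply/funext => z; rewrite mulrA; congr (_ * _).
  rewrite /Erad -mulrA; congr (_ * _).
  rewrite -cintegralZl//; congr cintegral; apply/funext => t.
  by rewrite /current mulrCA.
rewrite cintegralZl// mulrAC -mulNr; congr (_ * _).
have -> : cE k0 eta0 = - (jC R * eta0%:C / (4 * (pi : R)%:C * k0%:C)).
  by rewrite /cE mulNr.
(* The constant goes back inside the outer integral, then inside the inner one together with the
   profile of [q]; the integrands then agree pointwise. *)
rewrite mulNr; congr (- _); rewrite -cintegralZl// /mutual_impedance.
congr cintegral; apply/funext => z.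
rewrite mulrA mulrAC -cintegralZl//.
by congr cintegral; apply/funext => t; rewrite /K; ring.
Qed.

(** * Port equations and elimination of the currents *)

Lemma sum_element (V : nmodType) (Nt Nris Nr : nat)
    (F : element Nt Nris Nr -> V) :
  \sum_e F e =
  \sum_i F (inl (inl i)) + \sum_i F (inl (inr i)) + \sum_i F (inr i).
Proof. by rewrite !big_sumType. Qed.

Lemma row_sum_impedance (R : realType) (k0 eta0 : R) (m n : nat)
    (X : 'I_m -> wire R) (Y : 'I_n -> wire R) (I : 'cV[R[i]]_n) (x : 'I_m) :
  \sum_y mutual_impedance k0 eta0 (X x) (Y y) * I y 0 =
  (impedance_mx k0 eta0 X Y *m I) x 0.
Proof. by rewrite mxE; apply: eq_bigr => y _; rewrite mxE. Qed.

(** The loaded RIS equation reads [(Zris + Z_SS) IS = - (Z_ST IT + Z_SR IL)]; solving for [IS] and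
    substituting leaves Schur complements. [X] is kept arbitrary to serve both the transmitter and
    the receiver. *)
Lemma ris_elimination (R : realType) (k0 eta0 : R) (m nt ns nr : nat)
    (X : 'I_m -> wire R) (T : 'I_nt -> wire R) (S : 'I_ns -> wire R)
    (Rx : 'I_nr -> wire R) (Zris : 'M[R[i]]_ns)
    (IT : 'cV[R[i]]_nt) (IS : 'cV[R[i]]_ns) (IL : 'cV[R[i]]_nr) :
  Zris + impedance_mx k0 eta0 S S \in unitmx ->
  - (Zris *m IS) = impedance_mx k0 eta0 S T *m IT
    + impedance_mx k0 eta0 S S *m IS + impedance_mx k0 eta0 S Rx *m IL ->
  impedance_mx k0 eta0 X T *m IT + impedance_mx k0 eta0 X S *m IS
    + impedance_mx k0 eta0 X Rx *m IL =
  ris_mx k0 eta0 Zris X S T *m IT + ris_mx k0 eta0 Zris X S Rx *m IL.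
Proof.
move=> uW VS.
have IS_eq : IS = - (invmx (Zris + impedance_mx k0 eta0 S S)
    *m (impedance_mx k0 eta0 S T *m IT + impedance_mx k0 eta0 S Rx *m IL)).
  rewrite -[LHS](mulKmx uW) -mulmxN; congr (_ *m _).
  rewrite mulmxDl -[Zris *m IS]opprK VS.
  by rewrite addrAC opprD subrK.
rewrite [in LHS]IS_eq /ris_mx !mulmxBl !mulmxN !mulmxDr !mulmxA opprD !addrA.
exact: addrAC.
Qed.

Theorem theorem1 (R : realType) (k0 eta0 : R) (Hk0 : 0 < k0) (Heta0 : 0 < eta0)
  (Nt Nris Nr : nat)
  (HNt : (1 <= Nt)%N) (HNris : (1 <= Nris)%N) (HNr : (1 <= Nr)%N)
  (T : 'I_Nt -> wire R) (S : 'I_Nris -> wire R) (Rx : 'I_Nr -> wire R)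
  (Hwires : forall e : element Nt Nris Nr, wire_ok k0 (per_element T S Rx e))
  (VG VT IT : 'cV[R[i]]_Nt) (VS IS : 'cV[R[i]]_Nris) (VL IL : 'cV[R[i]]_Nr)
  (Hbc : boundary_conditions k0 eta0
    (fun e : element Nt Nris Nr => per_element T S Rx e)
    (per_element (fun t => VT t 0) (fun s => VS s 0) (fun r => VL r 0))
    (per_element (fun t => IT t 0) (fun s => IS s 0) (fun r => IL r 0)))
  (ZG : 'M[R[i]]_Nt) (ZRIS : 'M[R[i]]_Nris) (ZL : 'M[R[i]]_Nr)
  (HZG : is_diag_mx ZG) (HZRIS : is_diag_mx ZRIS) (HZL : is_diag_mx ZL)
  (HVT : VT = VG - ZG *m IT)
  (HVS : VS = - (ZRIS *m IS))
  (HVL : VL = - (ZL *m IL)) :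
  let PTST := ris_mx k0 eta0 ZRIS T S T in
  let PTSR := ris_mx k0 eta0 ZRIS T S Rx in
  let PRST := ris_mx k0 eta0 ZRIS Rx S T in
  let PRSR := ris_mx k0 eta0 ZRIS Rx S Rx in
  let PGTST := ZG + PTST in
  let D := 1%:M + PRSR *m invmx ZL
           - PRST *m invmx PGTST *m PTSR *m invmx ZL in
  ZL \in unitmx ->
  ZRIS + impedance_mx k0 eta0 S S \in unitmx ->
  PGTST \in unitmx ->
  D \in unitmx ->
  let HE2E := invmx D *m PRST *m invmx PGTST in
  VL = HE2E *m VG.
Proof.
move=> PTST PTSR PRST PRSR PGTST D uL uS uG uD HE2E.
(* The minus sign of the tested field cancels that of the boundary condition, giving [V = Z I] at
   each port. *)
have ports e : \sum_p mutual_impedance k0 eta0 (per_element T S Rx e)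
    (per_element T S Rx p)
    * per_element (fun t => IT t 0) (fun s => IS s 0) (fun r => IL r 0) p =
    per_element (fun t => VT t 0) (fun s => VS s 0) (fun r => VL r 0) e.
  apply: oppr_inj; rewrite -Hbc -sumrN; apply: eq_bigr => p _.
  by rewrite tested_field//; case: (Hwires p).
(* The map [f] embeds one group of wires [X] among all elements, so a single argument yields the
   block rows for S, T and R. *)
have port_eq m (X : 'I_m -> wire R) (V : 'cV_m)
    (f : 'I_m -> element Nt Nris Nr) :
    (forall x, per_element T S Rx (f x) = X x) ->
    (forall x, per_element (fun t => VT t 0) (fun s => VS s 0)
      (fun r => VL r 0) (f x) = V x 0) ->
    V = impedance_mx k0 eta0 X T *m IT + impedance_mx k0 eta0 X S *m IS
      + impedance_mx k0 eta0 X Rx *m IL.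
  move=> fX fV; apply/matrixP => x j; rewrite ord1 -fV -ports sum_element.
  by rewrite fX/= !row_sum_impedance !mxE.
have := port_eq _ S VS (fun s => inl (inr s)) (fun=> erefl) (fun=> erefl).
rewrite {1}HVS => VS_eq.
have := port_eq _ T VT (fun t => inl (inl t)) (fun=> erefl) (fun=> erefl).
rewrite (ris_elimination _ uS VS_eq) -/PTST -/PTSR.
move=> VT_eq.
have := port_eq _ Rx VL (fun r => inr r) (fun=> erefl) (fun=> erefl).
rewrite (ris_elimination _ uS VS_eq) -/PRST -/PRSR.
move=> VL_eq.
(* Only matrix algebra remains, so the four matrices become opaque. *)
clearbody PTST PTSR PRST PRSR.
have IL_eq : IL = - (invmx ZL *m VL) by rewrite HVL mulmxN mulKmx ?opprK.
(* The generator equation and the transmitter row combine into [PGTST IT = VG - PTSR IL]. *)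
have IT_eq : IT = invmx PGTST *m (VG + PTSR *m (invmx ZL *m VL)).
  rewrite -[LHS](mulKmx uG); congr (_ *m _).
  rewrite /PGTST mulmxDl -[VG](subrK (ZG *m IT)) -HVT VT_eq IL_eq mulmxN.
  by rewrite [RHS]addrAC subrK addrC.
(* Only the [VL] coming from the identity term of [D] is expanded by the receiver row; the other two
   terms of [D *m VL] then cancel against the contributions of [IL] and [IT]. *)
have DVL : D *m VL = PRST *m (invmx PGTST *m VG).
  rewrite /D mulmxBl mulmxDl mul1mx {1}VL_eq IL_eq IT_eq.
  by rewrite !mulmxDr !mulmxN !mulmxA subrK addrK.
by rewrite /HE2E -!mulmxA -DVL mulKmx.
Qed.
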